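(* For a linear network with line reactances $x_{ij}\in[a,b]$, where $b\ge a>0$, $\mathrm{PoSA}_{\max}$ is bounded by $$\mathrm{PoSA}_{\max}(X,Y)\le\frac{d^2}{(\lambda_n^{\mathrm{lower}}+d+y)^2\,(y+\lambda_n^{\mathrm{lower}})},\qquad \lambda_n^{\mathrm{lower}}=\frac{a}{2+2\cos\frac{2\pi}{2n+1}} .$$
   Context: Linear network of size $n$: the path $0-1-2-\cdots-n$ rooted at $0$ with lines $(i,i+1)$, $i=0,\dots,n-1$, of reactances $x_{i,i+1}$. The reactance matrix $X\in\mathbb R^{n\times n}$ is $X_{ij}=\sum_{k=0}^{\min(i,j)-1}x_{k,k+1}$. $D=\mathrm{diag}(X_{11},\dots,X_{nn})$; $Y=\mathrm{diag}(y_1,\dots,y_n)$ with all $y_i>0$; $d=\max_iX_{ii}$; $y=\min_i y_i$. For $\Delta\tilde v\in\mathbb R^n$ let $F(q)=\frac12q^\top(X+Y)q+q^\top\Delta\tilde v$ and $W(q)=\frac12q^\top(X+D+Y)q+q^\top\Delta\tilde v$ on $\mathbb R^n$, with unique minimizers $q^*=-(X+Y)^{-1}\Delta\tilde v$ and $q^a=-(X+D+Y)^{-1}\Delta\tilde v$ respectively. $\mathrm{PoSA}=F(q^a)-F(q^* )$ and $\mathrm{PoSA}_{\max}(X,Y)=\sup_{\Delta\tilde v\neq0}\frac{\mathrm{PoSA}}{\Delta\tilde v^\top\Delta\tilde v}$, which equals $\frac12\lambda_{\max}(\Pi)$ with $\Pi=(X+D+Y)^{-1}D(X+Y)^{-1}D(X+D+Y)^{-1}$.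 *)

(* Defs.v *)
From HB Require Import structures.
From mathcomp Require Import all_boot all_order all_algebra.
From mathcomp Require Import all_classical all_reals all_analysis.
Set Implicit Arguments.
Unset Strict Implicit.
Unset Printing Implicit Defensive.
Import Order.TTheory GRing.Theory Num.Theory.
Import numFieldNormedType.Exports.
Local Open Scope classical_set_scope.
Local Open Scope ring_scope.

(* A linear network of size n.+1 has nodes 0, ..., n.+1.  Indices are shifted:
   the coordinate i : 'I_n.+1 stands for the non-root node i + 1, and
   x k is the reactance of the line (k, k + 1). *)

(* X_{i+1,j+1} is the sum of x_{k,k+1} over k <= min(i+1, j+1) - 1 = min(i, j). *)
Definition reactance_mx (R : realType) (n : nat) (x : 'I_n.+1 -> R) :
    'M[R]_n.+1 :=
  \matrix_(i, j) \sum_(k < n.+1 | (k <= minn i j)%N) x k.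

Definition diag_part (R : realType) (n : nat) (X : 'M[R]_n.+1) : 'M[R]_n.+1 :=
  diag_mx (\row_i X i i).

Definition dotv (R : realType) (n : nat) (u v : 'cV[R]_n.+1) : R :=
  (u^T *m v) 0 0.

Definition objF (R : realType) (n : nat) (X Y : 'M[R]_n.+1)
    (v q : 'cV[R]_n.+1) : R :=
  2^-1 * dotv q ((X + Y) *m q) + dotv q v.

Definition objW (R : realType) (n : nat) (X Y : 'M[R]_n.+1)
    (v q : 'cV[R]_n.+1) : R :=
  2^-1 * dotv q ((X + diag_part X + Y) *m q) + dotv q v.

(* The value is a default when f has no minimizer; objF and objW have exactly
   one when X + Y and X + diag_part X + Y are positive definite. *)
Definition argmin (R : realType) (n : nat) (f : 'cV[R]_n.+1 -> R) :
    'cV[R]_n.+1 :=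
  xget 0 [set q | forall p, f q <= f p].

Definition PoSA (R : realType) (n : nat) (X Y : 'M[R]_n.+1)
    (v : 'cV[R]_n.+1) : R :=
  objF X Y v (argmin (objW X Y v)) - objF X Y v (argmin (objF X Y v)).

(* The supremum is extended-real, so that an upper bound on it is never an
   artefact of the default value of the real-valued sup on unbounded sets. *)
Definition PoSA_max (R : realType) (n : nat) (X Y : 'M[R]_n.+1) : \bar R :=
  ereal_sup [set (PoSA X Y v / dotv v v)%:E | v in [set v | v != 0]].

Definition max_diag (R : realType) (n : nat) (X : 'M[R]_n.+1) : R :=
  \big[Num.max/X ord0 ord0]_i X i i.

Definition min_entry (R : realType) (n : nat) (y : 'rV[R]_n.+1) : R :=
  \big[Num.min/y ord0 ord0]_i y ord0 i.

Definition lambda_lower (R : realType) (m : nat) (a : R) : R :=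
  a / (2 + 2 * cos (2 * pi / (2 * m%:R + 1))).

(* Main.v *)
Require Import Defs.
From HB Require Import structures.
From mathcomp Require Import all_boot all_order all_algebra.
From mathcomp Require Import all_classical all_reals all_analysis.
From mathcomp Require Import ring lra.
Import Order.TTheory GRing.Theory Num.Theory.
Local Open Scope ring_scope.

(** Write A = X + Y and mu = lam + ymin, let qs and qa minimise F and W for a
    given v, and let e = qa - qs.  The stationarity equations A qs = - v and
    (A + D) qa = - v give A e = - D qa, and since F is quadratic
      PoSA = (e . A e) / 2.
    Three facts bound this.

    - A is bounded below by mu ([reactance_coercive] for X, and Y >= ymin).
      In terms of the tail sums s_k = q_k + ... + q_n, the form q . X q is the
      sum of the x_k s_k^2, while q . q is the sum of the (s_k - s_(k+1))^2 with
      s_(n+1) = 0.  The smallest eigenvalue of X is thus at least a over the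
      largest eigenvalue of a path Laplacian with one free and one grounded
      end, namely 2 + 2 cos (2 pi / (2 (n + 1) + 1)) ([path_laplacian_le]).
      Hence e . A e <= |A e|^2 / mu = |D qa|^2 / mu, and |A q| >= mu |q|.

    - q . D A q >= 0, although D A is not symmetric.  As X_ij is the smaller of
      D_i and D_j, twice the symmetric part of D X has entries
      (D_i + D_j) X_ij = X_ij^2 + D_i D_j.  The second term is a rank one
      square, and the first is again the reactance matrix of a path, now with
      the nonnegative reactances D_k^2 - D_(k-1)^2
      ([diag_reactance_form_ge0]).

    - Therefore |v|^2 = |(A + D) qa|^2 >= |A qa|^2 + |D qa|^2.  Since
      |A qa| >= mu |qa| >= (mu / d) |D qa|, this is at least
      (1 + (mu / d)^2) |D qa|^2 >= (1 + mu / d)^2 |D qa|^2 / 2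
      ([damped_norm]).

    The factor lost in the last inequality is exactly the 1/2 in PoSA, so
    PoSA <= d^2 / ((mu + d)^2 mu) |v|^2 ([quad_gap_le]). *)

(** * The Euclidean inner product *)

Section Dot.
Context {R : realType} {n : nat}.
Implicit Types (u v w q : 'cV[R]_n.+1) (S : 'M[R]_n.+1).

Lemma dotvE u v : dotv u v = \sum_i u i 0 * v i 0.
Proof. by rewrite /dotv mxE; apply: eq_bigr => i _; rewrite mxE. Qed.

Lemma dotvC u v : dotv u v = dotv v u.
Proof. by rewrite !dotvE; apply: eq_bigr => i _; rewrite mulrC. Qed.

Lemma dotvDr u v w : dotv u (v + w) = dotv u v + dotv u w.
Proof. by rewrite /dotv mulmxDr mxE. Qed.

Lemma dotvZr c u v : dotv u (c *: v) = c * dotv u v.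
Proof. by rewrite /dotv -scalemxAr mxE. Qed.

Lemma dotvNr u v : dotv u (- v) = - dotv u v.
Proof. by rewrite -scaleN1r dotvZr mulN1r. Qed.

Lemma dotvDl u v w : dotv (v + w) u = dotv v u + dotv w u.
Proof. by rewrite dotvC dotvDr !(dotvC u). Qed.

Lemma dotvZl c u v : dotv (c *: u) v = c * dotv u v.
Proof. by rewrite dotvC dotvZr dotvC. Qed.

Lemma dotvNl u v : dotv (- u) v = - dotv u v.
Proof. by rewrite dotvC dotvNr dotvC. Qed.

Lemma dotv_ge0 u : 0 <= dotv u u.
Proof. by rewrite dotvE sumr_ge0// => i _; rewrite -expr2 sqr_ge0. Qed.

Lemma dotv_gt0 u : u != 0 -> 0 < dotv u u.
Proof.
move=> u0; rewrite lt0r dotv_ge0 andbT; apply: contra u0 => /eqP.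
rewrite dotvE => /psumr_eq0P H; apply/eqP/colP => i; rewrite mxE.
apply/eqP; rewrite -sqrf_eq0 expr2; apply/eqP/H => // j _.
by rewrite -expr2 sqr_ge0.
Qed.

Lemma dotv_sym S u v : S^T = S -> dotv u (S *m v) = dotv v (S *m u).
Proof.
by move=> Ssym; rewrite [RHS]dotvC /dotv trmx_mul Ssym mulmxA.
Qed.

End Dot.

(** * Coercive quadratic problems *)

Section Quadratic.
Context {R : realType} {n : nat}.
Implicit Types (v q : 'cV[R]_n.+1) (S A D : 'M[R]_n.+1).

Definition quad S v q : R := 2^-1 * dotv q (S *m q) + dotv q v.

Lemma quad_gap {S v q0} q : S^T = S -> S *m q0 = - v ->
  quad S v q - quad S v q0 = 2^-1 * dotv (q - q0) (S *m (q - q0)).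
Proof.
move=> Ssym Sq0.
have cross : dotv q0 (S *m q) = - dotv q v.
  by rewrite (dotv_sym S)// Sq0 dotvNr.
rewrite /quad mulmxBr !(dotvDr, dotvDl, dotvNr, dotvNl) cross Sq0 !dotvNr.
by field.
Qed.

Definition coercive (mu : R) S :=
  forall q, mu * dotv q q <= dotv q (S *m q).

Lemma coercive_unitmx {mu S} : 0 < mu -> coercive mu S -> S \in unitmx.
Proof.
move=> mu0 cS; rewrite unitmxE unitfE; apply/negP => /det0P[u u0 uS].
have := cS u^T; rewrite [X in _ <= X]/dotv trmxK mulmxA uS mul0mx mxE.
by apply/negP; rewrite -ltNge mulr_gt0// dotv_gt0// trmx_eq0.
Qed.

(** Coercivity provides the minimiser, so that [argmin] is not its default
    value, and makes it unique, so that it is the stationary point. *)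
Lemma argmin_quad {mu S} v : 0 < mu -> S^T = S -> coercive mu S ->
  S *m argmin (quad S v) = - v.
Proof.
move=> mu0 Ssym cS.
set q0 := - (invmx S *m v).
have Sq0 : S *m q0 = - v.
  by rewrite mulmxN mulmxA mulmxV ?mul1mx// (coercive_unitmx mu0 cS).
have q0min p : quad S v q0 <= quad S v p.
  rewrite -subr_ge0 (quad_gap p Ssym Sq0) mulr_ge0 ?invr_ge0//.
  by apply: le_trans (cS _); rewrite mulr_ge0 ?dotv_ge0 ?ltW.
have /(_ q0) := @xgetPex _ 0 [set q | forall p, quad S v q <= quad S v p]%classic
  (ex_intro _ q0 q0min).
rewrite -/(argmin (quad S v)); set q1 := argmin _ => q1min.
suff : q1 - q0 == 0 by rewrite subr_eq0 => /eqP ->.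
apply: contraT => q10.
have := quad_gap q1 Ssym Sq0; move: q1min (cS (q1 - q0)).
have := mulr_gt0 mu0 (dotv_gt0 _ q10); lra.
Qed.

(** Expand |A q - mu q|^2 >= 0 and use coercivity once: for a symmetric A this
    is A^2 >= mu A. *)
Lemma coercive_sq {mu A} q : 0 <= mu -> coercive mu A ->
  mu * dotv q (A *m q) <= dotv (A *m q) (A *m q).
Proof.
move=> mu0 cA.
have := dotv_ge0 (A *m q - mu *: q).
rewrite !(dotvDr, dotvDl, dotvNr, dotvNl, dotvZl, dotvZr) (dotvC (A *m q) q).
have := ler_wpM2l mu0 (cA q); lra.
Qed.

(** Since the cross term is nonnegative, |(A + D) q|^2 is at least
    |A q|^2 + |D q|^2 with |A q| >= (mu / d) |D q|; the constant 2 comes from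
    (mu + d)^2 <= 2 (mu^2 + d^2). *)
Lemma damped_norm {mu d A D} q : 0 <= mu -> 0 < d -> coercive mu A ->
  dotv (D *m q) (D *m q) <= d ^+ 2 * dotv q q ->
  0 <= dotv (D *m q) (A *m q) ->
  (mu + d) ^+ 2 * dotv (D *m q) (D *m q)
    <= 2 * d ^+ 2 * dotv ((A + D) *m q) ((A + D) *m q).
Proof.
move=> mu0 d0 cA Dd DA.
rewrite mulmxDl !(dotvDr, dotvDl) (dotvC (A *m q) (D *m q)).
have h1 : mu ^+ 2 * dotv q q <= dotv (A *m q) (A *m q).
  apply: le_trans (coercive_sq q mu0 cA).
  by rewrite expr2 -mulrA ler_wpM2l// cA.
have h2 : mu ^+ 2 * dotv (D *m q) (D *m q) <= d ^+ 2 * dotv (A *m q) (A *m q).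
  apply: le_trans (ler_wpM2l (sqr_ge0 d) h1).
  by rewrite mulrCA; apply: ler_wpM2l => //; apply: sqr_ge0.
have h3 := mulr_ge0 (sqr_ge0 d) DA.
have h4 := mulr_ge0 (sqr_ge0 (mu - d)) (dotv_ge0 (D *m q)).
nra.
Qed.

(** Subtracting the two stationarity equations gives A e = - D qa for
    e = qa - qs, so the excess cost (e . A e) / 2 is at most |D qa|^2 / (2 mu),
    and [damped_norm] bounds |D qa|^2 by |v|^2. *)
Lemma quad_gap_le {mu d A D v qa qs} : 0 < mu -> 0 < d -> A^T = A ->
  coercive mu A ->
  (forall q, dotv (D *m q) (D *m q) <= d ^+ 2 * dotv q q) ->
  (forall q, 0 <= dotv (D *m q) (A *m q)) ->
  A *m qs = - v -> (A + D) *m qa = - v ->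
  quad A v qa - quad A v qs <= d ^+ 2 / ((mu + d) ^+ 2 * mu) * dotv v v.
Proof.
move=> mu0 d0 Asym cA Dd DA As ADa; rewrite (quad_gap qa Asym As).
have Ae : A *m (qa - qs) = - (D *m qa).
  by rewrite mulmxBr As opprK -(opprK v) -ADa mulmxDl opprD addrA subrr add0r.
have := coercive_sq (qa - qs) (ltW mu0) cA.
set g := dotv (qa - qs) _; rewrite Ae dotvNl dotvNr opprK => h1.
have := damped_norm qa (ltW mu0) d0 cA (Dd qa) (DA qa).
rewrite ADa dotvNl dotvNr opprK => h2.
have md : 0 < (mu + d) ^+ 2 by rewrite exprn_gt0// addr_gt0.
rewrite mulrAC ler_pdivlMr; last exact: mulr_gt0.
have := ler_wpM2l (ltW md) h1.
nra.
Qed.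

End Quadratic.

(** * The largest eigenvalue of a half-grounded path Laplacian *)

Section Spectrum.
Context {R : realType}.

(** The constant is the largest eigenvalue of the quadratic form on the left, with
    th = 2 pi / (2 (m + 1) + 1).  Its eigenvector has the alternating entries
    (-1)^k u_k with u_k = sin ((k + 1/2) th): the free end at 0 requires
    u_(-1) = - u_0, the grounded end m + 1 requires u_(m+1) = 0, and u_k > 0 in
    between.  Completing squares from left to right with the ratios
    r_k = u_(k+1) / u_k proves the inequality; the recurrence of u becomes
    r_(k+1) = 2 cos th - 1 / r_k. *)
Lemma path_laplacian_le (m : nat) (s : nat -> R) : s m.+1 = 0 ->
  \sum_(i < m.+1) (s i - s i.+1) ^+ 2
    <= (2 + 2 * cos (2 * pi / (2 * m.+1%:R + 1))) * \sum_(i < m.+1) s i ^+ 2.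
Proof.
move=> sm.
set th := 2 * pi / _; set c := 2 + 2 * cos th.
pose u k : R := sin ((k%:R + 2^-1) * th).
have den0 : 0 < 2 * m.+1%:R + 1 :> R by rewrite addr_gt0 ?mulr_gt0.
have th0 : 0 < th by rewrite divr_gt0// mulr_gt0// pi_gt0.
have endth : (m.+1%:R + 2^-1) * th = pi.
  by rewrite /th; field; rewrite gt_eqF.
have u_end : u m.+1 = 0 by rewrite /u endth sinpi.
have u_gt0 k : (k <= m)%N -> 0 < u k.
  move=> km; apply: sin_gt0_pi; apply/andP; split.
    by rewrite mulr_gt0// ltr_wpDl ?invr_gt0.
  by rewrite -endth ltr_pM2r// ltrD2r ltr_nat.
have u_rec k : u k.+2 = 2 * cos th * u k.+1 - u k.
  rewrite /u.
  have -> : (k.+2%:R + 2^-1) * th = (k.+1%:R + 2^-1) * th + th.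
    by rewrite -(natr1 k.+1); ring.
  have -> : (k%:R + 2^-1) * th = (k.+1%:R + 2^-1) * th - th.
    by rewrite -(natr1 k); ring.
  by rewrite sinD sinB; ring.
have u1 : u 1%N = (1 + 2 * cos th) * u 0%N.
  pose h := 2^-1 * th.
  have thE : th = h + h by rewrite /h; field.
  have cth : cos th = 1 - 2 * sin h ^+ 2.
    by rewrite thE cosD; have := cos2Dsin2 h; lra.
  have sth : sin th = 2 * (sin h * cos h) by rewrite thE sinD; ring.
  have -> : u 1%N = sin (h + th) by rewrite /u /h; congr sin; ring.
  have -> : u 0%N = sin h by rewrite /u /h add0r.
  have cos2 : cos h ^+ 2 = 1 - sin h ^+ 2 by rewrite cos2sin2.
  rewrite sinD sth cth (_ : cos h * _ = 2 * sin h * cos h ^+ 2); last by ring.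
  by rewrite cos2; ring.
(* Minimising the difference of the two sides over s_0, ..., s_(k-1) leaves a
   multiple of s_k^2.  At k = m the ratio is 0, which leaves room for exactly
   the last difference, (s_m - 0)^2. *)
have step k : (k <= m)%N ->
  \sum_(i < k) (s i - s i.+1) ^+ 2 + (1 + u k.+1 / u k) * s k ^+ 2
    <= c * \sum_(i < k.+1) s i ^+ 2.
  elim: k => [|k IH] km.
    rewrite big_ord0 big_ord1 add0r u1 mulfK ?gt_eqF ?u_gt0//.
    by rewrite /c; lra.
  rewrite big_ord_recr [in leRHS]big_ord_recr/= mulrDr.
  have uk := u_gt0 k (ltnW km); have uk1 := u_gt0 _ km.
  have := IH (ltnW km).
  have -> : u k.+2 / u k.+1 = c - 2 - u k / u k.+1.
    by rewrite u_rec /c; field; rewrite gt_eqF.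
  set r := u k.+1 / u k.
  have r0 : 0 < r by rewrite divr_gt0.
  have -> : u k / u k.+1 = r^-1 by rewrite invf_div.
  suff : 0 <= r * s k ^+ 2 + 2 * s k * s k.+1 + r^-1 * s k.+1 ^+ 2 by lra.
  have -> : r * s k ^+ 2 + 2 * s k * s k.+1 + r^-1 * s k.+1 ^+ 2
     = r^-1 * (r * s k + s k.+1) ^+ 2 by field; rewrite gt_eqF.
  by rewrite mulr_ge0 ?sqr_ge0// invr_ge0 ltW.
apply: le_trans (step m (leqnn m)).
by rewrite big_ord_recr/= sm u_end subr0 mul0r addr0 mul1r.
Qed.

(** The preceding inequality on the indicator of the index 0 bounds the
    denominator of [lambda_lower] below by 1. *)
Lemma lambda_lower_den_gt0 (m : nat) :
  0 < 2 + 2 * cos (2 * pi / (2 * m.+1%:R + 1)) :> R.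
Proof.
have := path_laplacian_le m (fun i => (i == 0%N)%:R) erefl.
rewrite !big_ord_recl/= !big1/=; last 2 first.
- by move=> i _; rewrite expr0n.
- by move=> i _; rewrite subr0 expr0n.
by rewrite subr0 !addr0 !expr1n mulr1; apply: lt_le_trans.
Qed.

End Spectrum.

(** * Quadratic forms of the reactance matrix *)

Section Reactance.
Context {R : realType} {n : nat}.
Implicit Types (x z : 'I_n.+1 -> R) (q : 'cV[R]_n.+1).

Definition tail q (k : nat) : R := \sum_(i < n.+1 | (k <= i)%N) q i 0.

(** The reactance matrix is the sum over the lines k of z_k times the indicator
    of the square of the indices i, j >= k. *)
Lemma reactance_form z q :
  dotv q (reactance_mx z *m q) = \sum_k z k * tail q k ^+ 2.
Proof.
transitivity (\sum_(i < n.+1) \sum_(j < n.+1) \sum_(k < n.+1)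
  (if (k <= i)%N then q i 0 else 0) * (if (k <= j)%N then q j 0 else 0) * z k).
  rewrite dotvE; apply: eq_bigr => i _; rewrite mxE mulr_sumr.
  apply: eq_bigr => j _; rewrite mxE mulr_suml mulr_sumr big_mkcond/=.
  apply: eq_bigr => k _; rewrite leq_min.
  by case: (k <= i)%N; case: (k <= j)%N => /=; ring.
under eq_bigr do rewrite exchange_big/=.
rewrite exchange_big/=; apply: eq_bigr => k _.
rewrite (_ : tail q k = \sum_(i < n.+1) (if (k <= i)%N then q i 0 else 0));
  last by rewrite /tail big_mkcond.
rewrite expr2 mulrC mulr_suml mulr_suml.
apply: eq_bigr => i _; rewrite mulr_sumr mulr_suml.
by apply: eq_bigr => j _.
Qed.

Lemma tail_end q : tail q n.+1 = 0.
Proof. by rewrite /tail big_pred0// => i; rewrite leqNgt ltn_ord. Qed.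

Lemma tail_diff q (i : 'I_n.+1) : q i 0 = tail q i - tail q i.+1.
Proof.
rewrite /tail (bigD1 i)//= (eq_bigl (fun j : 'I_n.+1 => (i.+1 <= j)%N)) ?addrK//.
by move=> j /=; rewrite ltn_neqAle eq_sym andbC.
Qed.

(** The differences of consecutive tail sums are the entries of q, so the
    inequality for the path Laplacian bounds q . q by the sum of the squared
    tails, which is at most q . X q / a. *)
Lemma reactance_coercive (a : R) x : 0 < a -> (forall k, a <= x k) ->
  coercive (lambda_lower n.+1 a) (reactance_mx x).
Proof.
move=> a0 ax q; rewrite reactance_form /lambda_lower.
have c0 := @lambda_lower_den_gt0 R n.
have := path_laplacian_le n (tail q) (tail_end q).
rewrite (_ : \sum_(i < n.+1) (tail q i - tail q i.+1) ^+ 2 = dotv q q); last first.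
  by rewrite dotvE; apply: eq_bigr => i _; rewrite -tail_diff expr2.
move=> h; rewrite mulrAC ler_pdivrMr//.
apply: (@le_trans _ _ (a * (_ * \sum_(i < n.+1) tail q i ^+ 2))).
  by apply: ler_wpM2l h; apply: ltW.
rewrite mulrCA mulrC ler_pM2r// mulr_sumr ler_sum// => k _.
by rewrite ler_wpM2r ?sqr_ge0.
Qed.

Lemma reactance_sym x : (reactance_mx x)^T = reactance_mx x.
Proof. by apply/matrixP => i j; rewrite !mxE minnC. Qed.

Definition cumul x (m : nat) : R := \sum_(k < n.+1 | (k <= m)%N) x k.

Lemma cumul0 x : cumul x 0 = x ord0.
Proof.
rewrite /cumul (eq_bigl (pred1 ord0)) ?big_pred1_eq// => k /=.
by rewrite leqn0.
Qed.

Lemma cumulS x m (lt_mn : (m.+1 < n.+1)%N) :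
  cumul x m.+1 = cumul x m + x (Ordinal lt_mn).
Proof.
rewrite /cumul (bigD1 (Ordinal lt_mn))//= addrC; congr (_ + _).
by apply: eq_bigl => k; rewrite -val_eqE/= -[RHS]ltnS [RHS]ltn_neqAle andbC.
Qed.

(** The reactances x_k (2 c_k - x_k) are c_k^2 - c_(k-1)^2 for the cumulated sums
    c of x, written without the index k - 1; their sums telescope. *)
Lemma cumul_sqr x (m : nat) : (m < n.+1)%N ->
  cumul (fun k => x k * (2 * cumul x k - x k)) m = cumul x m ^+ 2.
Proof.
elim: m => [|m IH] mn; first by rewrite !cumul0; ring.
by rewrite !cumulS/= IH ?(ltnW mn)//; ring.
Qed.

(** With D the diagonal of X, the monotonicity of D along the path gives
    X_ij = min (D_i, D_j), whence (D_i + D_j) X_ij = X_ij^2 + D_i D_j.  The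
    matrix of the X_ij^2 is the reactance matrix of the nonnegative increments
    of D^2, so both terms are positive semidefinite, and so is the symmetric
    part of D X. *)
Lemma diag_reactance_form_ge0 x q : (forall k, 0 <= x k) ->
  0 <= dotv (diag_part (reactance_mx x) *m q) (reactance_mx x *m q).
Proof.
move=> x0; set X := reactance_mx x.
pose z k := x k * (2 * cumul x k - x k).
have XE i j : X i j = cumul x (minn i j) by rewrite mxE.
have entry i j : (X i i + X j j) * X i j = reactance_mx z i j + X i i * X j j.
  have -> : reactance_mx z i j = X i j ^+ 2.
    rewrite XE -cumul_sqr ?mxE//.
    by rewrite gtn_min ltn_ord.
  rewrite !XE !minnn.
  by case: (leqP i j) => _; ring.
have z0 k : 0 <= z k.
  rewrite mulr_ge0// (_ : _ - _ = cumul x k + (cumul x k - x k)); last by ring.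
  have : x k <= cumul x k.
    by rewrite /cumul (bigD1 k)//= lerDl sumr_ge0.
  by have := x0 k; lra.
have DE i : (diag_part X *m q) i 0 = X i i * q i 0.
  by rewrite /diag_part mul_diag_mx !mxE.
set L := dotv _ _.
have LE : L = \sum_i \sum_j X i i * X i j * (q i 0 * q j 0).
  rewrite /L dotvE; apply: eq_bigr => i _; rewrite DE [(X *m q) i 0]mxE mulr_sumr.
  by apply: eq_bigr => j _; ring.
(* D X is not symmetric: adding the form with i and j exchanged isolates its
   symmetric part. *)
have LE' : L = \sum_i \sum_j X j j * X i j * (q i 0 * q j 0).
  rewrite LE exchange_big/=; apply: eq_bigr => i _; apply: eq_bigr => j _.
  by rewrite !XE minnC (mulrC (q j 0)).
have L2 : L + L = dotv q (reactance_mx z *m q) + (\sum_i X i i * q i 0) ^+ 2.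
  rewrite {1}LE LE' -big_split/= dotvE expr2 mulr_suml -big_split/=.
  apply: eq_bigr => i _; rewrite -big_split/= [(_ *m q) i 0]mxE.
  rewrite !mulr_sumr -big_split/=.
  apply: eq_bigr => j _; rewrite -mulrDl -mulrDl entry; ring.
have : 0 <= L + L.
  rewrite L2 addr_ge0 ?sqr_ge0// reactance_form sumr_ge0// => k _.
  by rewrite mulr_ge0 ?sqr_ge0.
lra.
Qed.

End Reactance.

(** * The bound on the excess cost *)

Theorem theorem9 (R : realType) (n : nat) (a b : R)
    (x : 'I_n.+1 -> R) (y : 'rV[R]_n.+1)
    (a_gt0 : 0 < a) (le_ab : a <= b)
    (x_ab : forall k : 'I_n.+1, a <= x k <= b)
    (y_gt0 : forall i : 'I_n.+1, 0 < y ord0 i) :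
  let X := reactance_mx x in
  let d := max_diag X in
  let ymin := min_entry y in
  let lam := lambda_lower n.+1 a in
  (PoSA_max X (diag_mx y)
     <= (d ^+ 2 / ((lam + d + ymin) ^+ 2 * (ymin + lam)))%:E)%E.
Proof.
cbv zeta; set X := reactance_mx x; set d := max_diag X.
set ymin := min_entry y; set lam := lambda_lower n.+1 a.
have ax k : a <= x k by have /andP[] := x_ab k.
have x0 k : 0 <= x k by apply: le_trans (ax k); apply: ltW.
have lam0 : 0 < lam by rewrite divr_gt0 ?lambda_lower_den_gt0.
have ymin0 : 0 < ymin by apply/bigmin_gtP; split.
have Dle (i : 'I_n.+1) : X i i <= d by apply: (le_bigmax _ (fun j => X j j)).
have D0 i : 0 <= X i i by rewrite mxE sumr_ge0.
have d0 : 0 < d.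
  apply: lt_le_trans (Dle ord0); rewrite mxE (bigD1 ord0)//=.
  by rewrite ltr_pwDl ?sumr_ge0// (lt_le_trans a_gt0).
pose A := X + diag_mx y; pose D := diag_part X.
have DqE q i : (D *m q) i 0 = X i i * q i 0.
  by rewrite /D /diag_part mul_diag_mx !mxE.
have YqE q i : (diag_mx y *m q) i 0 = y 0 i * q i 0.
  by rewrite mul_diag_mx !mxE.
have Asym : A^T = A by rewrite linearD/= reactance_sym tr_diag_mx.
have ADsym : (A + D)^T = A + D by rewrite linearD/= Asym tr_diag_mx.
have mu0 : 0 < lam + ymin by apply: addr_gt0.
have cA : coercive (lam + ymin) A.
  move=> q; rewrite mulmxDl dotvDr mulrDl lerD//; first exact: reactance_coercive.
  rewrite !dotvE mulr_sumr ler_sum// => i _.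
  rewrite YqE [leRHS]mulrCA -expr2.
  by apply: ler_wpM2r; [exact: sqr_ge0 | exact: bigmin_le].
have Dd q : dotv (D *m q) (D *m q) <= d ^+ 2 * dotv q q.
  rewrite !dotvE mulr_sumr ler_sum// => i _; rewrite DqE.
  rewrite mulrACA -!expr2 ler_wpM2r ?sqr_ge0// ler_sqr ?nnegrE//.
  exact: ltW.
have DA q : 0 <= dotv (D *m q) (A *m q).
  rewrite mulmxDl dotvDr addr_ge0//; first exact: diag_reactance_form_ge0.
  rewrite dotvE sumr_ge0// => i _; rewrite DqE YqE mulrACA -expr2.
  by rewrite mulr_ge0 ?sqr_ge0// mulr_ge0// ltW.
have cAD : coercive (lam + ymin) (A + D).
  move=> q; rewrite mulmxDl dotvDr; apply: le_trans (cA q) _.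
  rewrite lerDl dotvE sumr_ge0// => i _; rewrite DqE mulrCA -expr2.
  by rewrite mulr_ge0 ?sqr_ge0.
apply: ub_ereal_sup => _ [v v0 <-].
rewrite lee_fin ler_pdivrMr ?dotv_gt0//.
rewrite addrAC (addrC ymin).
have XDY : X + diag_part X + diag_mx y = A + D by rewrite addrAC.
rewrite /PoSA.
have -> : objW X (diag_mx y) v = quad (A + D) v by rewrite -XDY.
apply: (quad_gap_le mu0 d0 Asym cA Dd DA).
  exact: (argmin_quad _ mu0 Asym cA).
exact: (argmin_quad _ mu0 ADsym cAD).
Qed.
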